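(* Let $n\geq 2$ and let $\mathbf v_1,\dots,\mathbf v_n$ be distinct points in $\mathbb R^d$. Let $\mathbf V$ be the $n\times n$ real symmetric matrix whose $(i,j)$ entry is $\|\mathbf v_i-\mathbf v_j\|^2$. Then $\mathbf V$ has exactly one positive eigenvalue.
   Context: $\|\cdot\|$ is the Euclidean norm on $\mathbb R^d$. Eigenvalues are counted with multiplicity. *)

(* Defs.v *)
From HB Require Import structures.
From mathcomp Require Import all_boot all_order all_algebra.
From mathcomp Require Import reals.

Set Implicit Arguments.
Unset Strict Implicit.
Unset Printing Implicit Defensive.

Import Order.TTheory GRing.Theory Num.Theory.

Local Open Scope ring_scope.

(* The library's norm on ['rV_d] is the supremum norm, hence this definition. *)
Definition enorm (R : realType) (d : nat) (x : 'rV[R]_d) : R :=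
  Num.sqrt (\sum_(k < d) x 0 k ^+ 2).

Definition sqdist_mx (R : realType) (d n : nat) (v : 'I_n -> 'rV[R]_d) :
    'M[R]_n :=
  \matrix_(i < n, j < n) enorm (v i - v j) ^+ 2.

(* Multiplicity is algebraic: [mup a (char_poly A)] is the order of [a] as a
   root of the characteristic polynomial. *)
Definition exactly_one_pos_eigenvalue (R : realType) (n : nat) (A : 'M[R]_n) :
    Prop :=
  exists a : R,
    [/\ 0 < a, eigenvalue A a, mup a (char_poly A) = 1%N &
        forall b : R, 0 < b -> eigenvalue A b -> b = a].

(* Main.v *)
Require Import Defs.
From HB Require Import structures.
From mathcomp Require Import all_boot all_order all_algebra.
From mathcomp Require Import reals.
From mathcomp Require Import complex.

(** Expanding the squared distances gives [V = s 1^T + 1 s^T - 2 M M^T], where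
    the rows of [M] are the points and [s] lists their squared norms.  On the
    hyperplane of vectors whose entries sum to zero the first two terms vanish,
    so the quadratic form of [V] is nonpositive there ([sqdist_form_le0]).

    Two orthogonal eigenvectors with positive eigenvalues would span a plane on
    which the form is positive definite, and a plane always meets a hyperplane:
    hence at most one eigenvalue is positive, counted with multiplicity
    ([hermitian_pos_eigen_unique]).  At least one is, because the trace of [V]
    is zero while [V] itself is not, the points being distinct.

    The orthogonal diagonalization comes from the spectral theorem for Hermitian
    matrices, applied to [V] over the complex numbers.  The eigenvalues are
    real, and [symmetric_real_spectrum] brings the factorization of the
    characteristic polynomial back to [R], which turns the count of positive
    diagonal entries into a statement about algebraic multiplicities. *)

Set Implicit Arguments.
Unset Strict Implicit.
Unset Printing Implicit Defensive.

Import Order.TTheory GRing.Theory Num.Theory.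

Local Open Scope ring_scope.

Lemma char_poly_conj (F : fieldType) n (P A : 'M[F]_n) :
  P \in unitmx -> char_poly (invmx P *m A *m P) = char_poly A.
Proof.
move=> Pu; pose Q := map_mx polyC P; pose Q' := map_mx polyC (invmx P).
have QQ : Q' *m Q = 1%:M by rewrite -map_mxM mulVmx // map_mx1.
have -> : char_poly (invmx P *m A *m P) = \det (Q' *m char_poly_mx A *m Q).
  congr (\det _); rewrite /char_poly_mx !map_mxM /= mulmxBr mulmxBl.
  by rewrite mul_mx_scalar -scalemxAl QQ scalemx1.
by rewrite !det_mulmx mulrC mulrA -det_mulmx (mulmx1C QQ) det1 mul1r.
Qed.

Section HermitianForm.

Local Open Scope sesquilinear_scope.

Variable C : numClosedFieldType.

Lemma diag_form n (c e : 'rV[C]_n) :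
  (c *m diag_mx e *m c^t*) 0 0 = \sum_k `|c 0 k| ^+ 2 * e 0 k.
Proof.
rewrite mxE; apply: eq_bigr => k _.
by rewrite mul_mx_diag !mxE normCK mulrAC.
Qed.

(** One half of Sylvester's law of inertia: the form cannot be positive definite
    on a plane when it is nonpositive on the hyperplane [x *m w = 0]. *)
Lemma hermitian_pos_eigen_unique n (A : 'M[C]_n) (w : 'cV[C]_n) :
    A \is hermsymmx ->
    (forall x : 'rV_n, x *m w = 0 -> (x *m A *m x^t*) 0 0 <= 0) ->
  forall i j, 0 < spectral_diag A 0 i -> 0 < spectral_diag A 0 j -> i = j.
Proof.
move=> /hermitian_normalmx /orthomx_spectralP A_eq form_le0 i j.
move: A_eq; set P := spectralmx A; set e := spectral_diag A => A_eq ei ej.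
have Pu : P \is unitarymx by apply: spectral_unitarymx.
pose u := P *m w.
have form (c : 'rV_n) : c *m u = 0 -> \sum_k `|c 0 k| ^+ 2 * e 0 k <= 0.
  move=> cu0; rewrite -(diag_form c e).
  have := form_le0 (c *m P); rewrite -mulmxA => /(_ cu0).
  rewrite A_eq invmx_unitary // trmx_mul map_mxM !mulmxA.
  by rewrite !mulmxtVK.
apply/eqP/negP => /negP ij.
(* The vectors of the hyperplane in the span of the i-th and j-th eigenvectors;
   [u] holds the values of the functional [w] on the eigenvectors. *)
have form2 a b : a * u i 0 + b * u j 0 = 0 ->
    `|a| ^+ 2 * e 0 i + `|b| ^+ 2 * e 0 j <= 0.
  move=> ab0; pose c : 'rV_n := a *: delta_mx 0 i + b *: delta_mx 0 j.
  have : \sum_k `|c 0 k| ^+ 2 * e 0 k <= 0.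
    apply: form; rewrite mulmxDl -!scalemxAl -!rowE.
    by apply/matrixP => p q; rewrite !ord1 [in RHS]mxE -ab0 !mxE.
  rewrite (bigD1 i) //= (bigD1 j) 1?eq_sym //= big1 => [|k /andP[ki kj]].
    rewrite !mxE !eqxx (negPf ij) eq_sym (negPf ij) !mulr1 !mulr0.
    by rewrite !addr0 add0r.
  by rewrite !mxE !eqxx (negPf ki) (negPf kj) !mulr0 addr0 normr0 expr0n mul0r.
(* If [u i 0 = 0], the i-th eigenvector itself is in the hyperplane; otherwise
   the coefficients [u j 0] and [- u i 0] give a nonzero vector there. *)
have [ui0|ui0] := eqVneq (u i 0) 0.
  have := form2 1 0; rewrite ui0 mulr0 mul0r addr0 => /(_ erefl).
  by rewrite normr1 normr0 expr1n expr0n mul1r mul0r addr0 (lt_geF ei).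
have := form2 (u j 0) (- u i 0).
rewrite mulrC mulNr subrr normrN => /(_ erefl); rewrite lt_geF //.
rewrite ltr_wpDl ?mulr_ge0 ?exprn_ge0 ?(ltW ei) //.
by rewrite mulr_gt0 // exprn_gt0 // normr_gt0.
Qed.

(** On the hyperplane of vectors with zero sum only the Gram term survives, and
    the form equals minus twice the squared norm of [x *m M].  Vectors are
    complex because the eigenvectors come from the complex spectral theorem. *)
Lemma sqdist_form_le0 n d (A : 'M[C]_n) (s : 'cV[C]_n)
    (M : 'M[C]_(n, d)) (x : 'rV[C]_n) :
    M \is a mxOver Num.real ->
    A = s *m (const_mx 1)^T + const_mx 1 *m s^T - (M *m M^T) *+ 2 ->
    x *m (const_mx 1 : 'cV_n) = 0 ->
  (x *m A *m x^t*) 0 0 <= 0.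
Proof.
move=> Mreal -> x1.
have x1' : (const_mx 1 : 'cV[C]_n)^T *m x^t* = 0.
  have := congr1 (fun B : 'M[C]_1 => B^t*) x1.
  rewrite trmx_mul map_mxM trmx0 map_mx0.
  by rewrite -[in X in X -> _]map_trmx map_const_mx rmorph1.
have -> : x *m (s *m (const_mx 1)^T + const_mx 1 *m s^T - (M *m M^T) *+ 2)
    *m x^t* = - ((x *m M) *m (x *m M)^t*) *+ 2.
  rewrite mulmxBr mulmxDr mulmxBl mulmxDl !mulmxA x1 !mul0mx.
  rewrite -[x *m s *m _ *m _]mulmxA x1' mulmx0 !add0r.
  rewrite mulNrn; congr (- _).
  rewrite trmx_mul map_mxM -[map_mx _ M^T]map_trmx (realmxC Mreal) !mulmxA.
  by rewrite !mulr2n mulmxDr mulmxDl !mulmxA.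
(* The squared norm is the form of the identity matrix, hence diagonal. *)
have -> : x *m M *m (x *m M)^t* = x *m M *m diag_mx (const_mx 1) *m (x *m M)^t*.
  by rewrite diag_const_mx mulmx1.
rewrite mulr2n 2!mxE diag_form -opprD oppr_le0.
suff S : 0 <= \sum_k `|(x *m M) 0 k| ^+ 2 * (const_mx 1 : 'rV[C]_d) 0 k.
  exact: addr_ge0.
by apply: sumr_ge0 => k _; rewrite mulr_ge0 ?exprn_ge0 // mxE.
Qed.

End HermitianForm.

Section RealSymmetric.

Local Open Scope sesquilinear_scope.

Variable R : realType.
Local Notation toC := (real_complex R).

Lemma symmetric_map_hermsym n (A : 'M[R]_n) :
  A^T = A -> map_mx toC A \is hermsymmx.
Proof.
move=> A_sym; apply: realsym_hermsym.
  by apply/is_hermitianmxP; rewrite expr0 scale1r map_mx_id // map_trmx A_sym.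
by apply/mxOverP => i j; rewrite mxE complex_real.
Qed.

(** Descent of the spectral theorem from the complex numbers: the diagonal is
    real, so both the characteristic polynomial and the trace can be read off
    in [R]. *)
Lemma symmetric_real_spectrum n (A : 'M[R]_n) :
    A^T = A ->
  exists r : 'rV[R]_n,
    [/\ map_mx toC r = spectral_diag (map_mx toC A),
        char_poly A = \prod_i ('X - (r 0 i)%:P) & \sum_i r 0 i = \tr A].
Proof.
move=> A_sym; have AC := symmetric_map_hermsym A_sym.
have := AC => /hermitian_normalmx /orthomx_spectralP.
set P := spectralmx _; set e := spectral_diag _ => A_eq.
have Pu : P \in unitmx := spectral_unit _.
pose r : 'rV[R]_n := \row_i complex.Re (e 0 i).
have rE i : toC (r 0 i) = e 0 i.
  rewrite mxE; apply: RRe_real.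
  by have /mxOverP := hermitian_spectral_diag_real AC; apply.
exists r; split.
- by apply/matrixP => i j; rewrite mxE ord1 rE.
- apply: (map_poly_inj toC); rewrite map_char_poly A_eq char_poly_conj //.
  rewrite char_poly_trig ?diag_mx_is_trig // rmorph_prod; apply: eq_bigr => i _.
  by rewrite mxE eqxx mulr1n -rE /= map_polyXsubC.
- apply: (@complexI R).
  rewrite rmorph_sum /= -trace_map_mx A_eq mxtrace_mulC mulmxA mulmxV // mul1mx.
  by rewrite mxtrace_diag; apply: eq_bigr => i _; rewrite -rE.
Qed.

(** The trace condition supplies a positive eigenvalue: if all were nonpositive,
    a nonnegative sum would force them all to vanish, and with them the
    diagonalizable matrix [A].  The condition on the form gives uniqueness. *)
Lemma exactly_one_pos_eigenvalue_of_form n (A : 'M[R]_n) (w : 'cV[R[i]]_n) :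
    A^T = A -> A != 0 -> 0 <= \tr A ->
    (forall x : 'rV_n, x *m w = 0 -> (x *m map_mx toC A *m x^t*) 0 0 <= 0) ->
  exactly_one_pos_eigenvalue A.
Proof.
move=> A_sym A_neq0 trA form_le0.
have [r [e_eq chA sum_r]] := symmetric_real_spectrum A_sym.
have AC := symmetric_map_hermsym A_sym.
have r_uniq i j : 0 < r 0 i -> 0 < r 0 j -> i = j.
  move=> ri rj; apply: (hermitian_pos_eigen_unique AC form_le0);
    by rewrite -e_eq mxE ltcR.
have [i ri] : exists i, 0 < r 0 i.
  apply/existsP; apply: contraT => /existsPn r_le0.
  have r_npos k : 0 <= - r 0 k by rewrite oppr_ge0 leNgt r_le0.
  have sum0 : \sum_k - r 0 k = 0.
    apply/eqP; rewrite eq_le sumr_ge0 // andbT.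
    by rewrite sumrN sum_r oppr_le0.
  have r0 k : r 0 k = 0.
    by apply: oppr_inj; rewrite oppr0; apply: psumr_eq0P sum0 _ _.
  case/negP: A_neq0; rewrite -(map_mx_eq0 toC).
  have /hermitian_normalmx /orthomx_spectralP -> := AC.
  rewrite -e_eq (_ : diag_mx _ = 0) ?mulmx0 ?mul0mx //.
  by apply/matrixP => p q; rewrite !mxE r0 mul0rn.
have {}chA : char_poly A = \prod_(x <- map (r 0) (enum 'I_n)) ('X - x%:P).
  by rewrite big_map big_enum chA.
exists (r 0 i); split => //.
- by rewrite eigenvalue_root_char chA root_prod_XsubC map_f ?mem_enum.
- rewrite chA mu_prod_XsubC count_map (@eq_count _ _ (pred1 i)) => [|k] /=.
    by rewrite count_uniq_mem ?enum_uniq // mem_enum.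
  by apply/eqP/eqP => [rk|-> //]; apply: r_uniq; rewrite ?rk.
move=> b b_gt0; rewrite eigenvalue_root_char chA root_prod_XsubC.
by case/mapP => j _ bE; rewrite bE (r_uniq j i) // -bE.
Qed.

End RealSymmetric.

Lemma sqdist_mxE (R : realType) d n (v : 'I_n -> 'rV[R]_d) i j :
  sqdist_mx v i j = \sum_k (v i 0 k - v j 0 k) ^+ 2.
Proof.
rewrite mxE sqr_sqrtr ?sumr_ge0 // => [|k _]; last exact: sqr_ge0.
by apply: eq_bigr => k _; rewrite !mxE.
Qed.

Theorem lemma2 (R : realType) (d n : nat) (hn : (2 <= n)%N)
    (v : 'I_n -> 'rV[R]_d) (hv : injective v) :
  exactly_one_pos_eigenvalue (sqdist_mx v).
Proof.
apply: (@exactly_one_pos_eigenvalue_of_form _ _ _ (const_mx 1)).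
- apply/matrixP => i j; rewrite mxE !sqdist_mxE; apply: eq_bigr => k _.
  by rewrite -sqrrN opprB.
- apply/eqP => /matrixP V0.
  pose i : 'I_n := Ordinal (ltnW hn); pose j : 'I_n := Ordinal hn.
  suff /hv /(congr1 val) : v i = v j by [].
  apply/rowP => k; apply/eqP; rewrite -subr_eq0 -sqrf_eq0; apply/eqP.
  have := V0 i j; rewrite sqdist_mxE mxE => s0.
  by apply: psumr_eq0P s0 _ _ => // l _; apply: sqr_ge0.
- apply: sumr_ge0 => i _; rewrite sqdist_mxE.
  by apply: sumr_ge0 => k _; apply: sqr_ge0.
move=> x; apply: (@sqdist_form_le0 _ _ _ _
  (map_mx (real_complex R) (\col_i \sum_k v i 0 k ^+ 2))
  (map_mx (real_complex R) (\matrix_i v i))).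
  by apply/mxOverP => i j; rewrite mxE complex_real.
rewrite -[const_mx 1](map_const_mx (real_complex R)).
rewrite !map_trmx -!map_mxM mulr2n -!map_mxD -map_mxB -mulr2n; congr map_mx.
apply/matrixP => i j; rewrite sqdist_mxE !mxE !big_ord1 !mxE mulr1 mul1r.
rewrite -!big_split -sumrB; apply: eq_bigr => k _ /=.
by rewrite !mxE sqrrB addrAC mulr2n.
Qed.
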